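(* Let $A=(a_{ij})$ be a real $n\times n$ matrix that is an $M$-matrix, and write $A^{-1}=(\tilde a_{ij})$. Then for all $i,j\in\{1,\dots,n\}$ with $i\neq j$, one has $\tilde a_{ij}>0$ if and only if there is a (directed) path from $v_i$ to $v_j$ in the digraph $\mathcal{D}(A)$.
   Context: For a real matrix $B$, $B\ge 0$ means all entries of $B$ are non-negative. A $Z$-matrix is a real square matrix whose off-diagonal entries are all non-positive; any such matrix can be written $A=sI-B$ with $s\in\mathbb{R}$ and $B\ge 0$. An $M$-matrix is a matrix of the form $A=sI-B$ with $B\ge 0$ and $s>\rho(B)$, where $\rho(B)$ is the spectral radius of $B$ (in particular, every $M$-matrix here is nonsingular). For a real $n\times n$ matrix $A=(a_{ij})$, the digraph $\mathcal{D}(A)$ has vertex set $\{v_1,\dots,v_n\}$, and its directed edges are the ordered pairs $(v_i,v_j)$ with $i\ne j$ and $a_{ij}\neq 0$. A path from $v_i$ to $v_j$ (for $i\neq j$) is a sequence of distinct vertices $v_i=v_{i_1},v_{i_2},\dots,v_{i_k}=v_j$ such that each $(v_{i_r},v_{i_{r+1}})$, $1\le r\le k-1$, is a directed edge of $\mathcal{D}(A)$. *)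

(* Defs.v *)
From mathcomp Require Import all_boot all_order all_algebra.
From mathcomp Require Import classical_sets reals complex.

Set Implicit Arguments.
Unset Strict Implicit.
Unset Printing Implicit Defensive.

Import Order.TTheory GRing.Theory Num.Theory.
Local Open Scope ring_scope.
Local Open Scope classical_set_scope.

Definition nonneg_mx (R : realType) (n : nat) (B : 'M[R]_n) : Prop :=
  forall i j : 'I_n, 0 <= B i j.

(* The eigenvalues are those of B seen as a complex matrix. For n > 0 the set
   of their moduli is finite and nonempty, so that its supremum is its maximum;
   for n = 0 it is empty and the value is 0. *)
Definition spectral_radius (R : realType) (n : nat) (B : 'M[R]_n) : R :=
  sup [set r : R | exists lambda : R[i],
         eigenvalue (map_mx (real_complex R) B) lambda /\
         r = ComplexField.Normc.normc lambda].

Definition is_M_matrix (R : realType) (n : nat) (A : 'M[R]_n) : Prop :=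
  exists (s : R) (B : 'M[R]_n),
    [/\ nonneg_mx B, spectral_radius B < s & A = s%:M - B].

Definition digraph_edge (R : realType) (n : nat) (A : 'M[R]_n) : rel 'I_n :=
  [rel i j | (i != j) && (A i j != 0)].

(* The path is i :: p; in mathcomp p lists the vertices after the start i. *)
Definition has_path (R : realType) (n : nat) (A : 'M[R]_n) (i j : 'I_n) : Prop :=
  exists p : seq 'I_n,
    [/\ path (digraph_edge A) i p, last i p = j & uniq (i :: p)].

(* Main.v *)
Require Import Defs.
From mathcomp Require Import all_boot all_order all_algebra.
From mathcomp Require Import reals.
From mathcomp Require Import classical_sets complex polyrcf lra.

Import Order.TTheory GRing.Theory Num.Theory.

Local Open Scope ring_scope.

(** The inverse [N] of an M-matrix [A = s I - B] is non-negative, and its zero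
pattern is read off the identity [A N = I] together with one comparison.

Non-negativity is handled through monotonicity ([A x >= 0] implies [x >= 0]),
which for an invertible matrix is the same as [N >= 0]. No power series is
summed; instead the parameter [t] in [t I - B] descends from [+oo] to [s].
Every [t I - B] with [t >= s] is invertible, since a real eigenvalue [t] of [B]
satisfies [t <= rho(B) < s] ([unitmx_above_spectral_radius]). For large [t] the
matrix is row diagonally dominant, hence monotone ([monotone_row_dominant]).
Monotonicity survives a small decrease of [t] ([monotone_left_open]) and passes
to the limit from the right ([nonneg_invmx_right_closed]), so it cannot be lost
before [s] ([monotone_of_unitmx_above]).

Given [N >= 0], the diagonal of [A] is positive and row [k] of [A N = I] reads
[A_kk N_kl = delta_kl + sum_(m != k) (- A_km) N_ml] with all terms non-negative.
Hence [N_ll > 0], and positivity of [N_ml] propagates to [N_kl] along an edge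
from [k] to [m] ([invmx_gt0_path]). Conversely, cutting column [l] of [N] down
to the vertices connected to [l] yields a vector [y] with [A y >= e_l], so
[y >= N e_l] by monotonicity; thus [N_kl = 0] when [k] is not connected to [l]
([invmx_le0_disconnected]). *)

(** * Monotone matrices *)

Definition nonneg_cV {R : realType} {n : nat} (x : 'cV[R]_n) : Prop :=
  forall k, 0 <= x k 0.

Definition monotone_mx {R : realType} {n : nat} (A : 'M[R]_n) : Prop :=
  forall x : 'cV[R]_n, nonneg_cV (A *m x) -> nonneg_cV x.

Lemma monotone_mx_unitP {R : realType} {n : nat} (A : 'M[R]_n) :
  A \in unitmx -> monotone_mx A <-> nonneg_mx (invmx A).
Proof.
move=> uA; split=> [mA k l | pA x pAx k].
  have -> : invmx A k l = col l (invmx A) k 0 by rewrite mxE.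
  apply: mA => {}k; rewrite colE mulmxA mulmxV // -colE !mxE.
  exact: ler0n.
rewrite -[x](mulKmx uA) mxE; apply: sumr_ge0 => l _.
exact: mulr_ge0 (pA _ _) (pAx _).
Qed.

Lemma scalar_subE {R : realType} {n : nat} (a : R) (C : 'M[R]_n)
    (x : 'cV[R]_n) k :
  ((a%:M - C) *m x) k 0 = a * x k 0 - \sum_l C k l * x l 0.
Proof. by rewrite mulmxBl mul_scalar_mx !mxE. Qed.

(** At an index where [x] attains a negative minimum, replacing every [x_l] by
that minimum shows that the corresponding entry of [(a I - C) x] is negative. *)
Lemma monotone_row_dominant {R : realType} {n : nat} (a : R) (C : 'M[R]_n) :
  nonneg_mx C -> (forall k, \sum_l C k l < a) -> monotone_mx (a%:M - C).
Proof.
move=> C_ge0 C_lt x Ax_ge0 k0; rewrite leNgt; apply/negP => xk0_lt0.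
case: (Order.TotalTheory.arg_minP (fun k => x k 0) (erefl (predT k0))).
move=> k _ k_min.
have xk_lt0 : x k 0 < 0 by apply: le_lt_trans xk0_lt0; exact: k_min.
have := Ax_ge0 k; rewrite scalar_subE leNgt => /negP; apply.
rewrite subr_lt0.
have : a * x k 0 < \sum_l C k l * x k 0.
  by rewrite -mulr_suml ltr_nM2r.
move=> /lt_le_trans; apply; apply: ler_sum => l _.
by rewrite ler_wpM2l ?C_ge0 // k_min.
Qed.

(** * The spectral radius and invertibility *)

Lemma normc_real {R : realType} (t : R) :
  ComplexField.Normc.normc (real_complex R t) = `|t|.
Proof. by rewrite /= expr0n addr0 sqrtr_sqr. Qed.

(** Otherwise [t] is an eigenvalue of [B], so [|t|] is one of the moduli whose
supremum is the spectral radius. The supremum is meaningful only once these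
moduli are bounded, which holds because the complex characteristic polynomial
has finitely many roots. *)
Lemma unitmx_above_spectral_radius {R : realType} {n : nat} (B : 'M[R]_n)
    (t : R) :
  spectral_radius B < t -> t%:M - B \in unitmx.
Proof.
move=> ltBt; apply/negPn/negP => Nunit.
have rt : root (char_poly B) t.
  rewrite -eigenvalue_root_char; apply/eigenvalueP.
  move: Nunit; rewrite -row_free_unit -kermx_eq0 => /rowV0Pn[v].
  rewrite sub_kermx mulmxBr mul_mx_scalar subr_eq0 => /eqP e v0.
  by exists v.
pose q := char_poly (map_mx (real_complex R) B).
have [rs q_split] := closed_field_poly_normal q.
have eigB z : eigenvalue (map_mx (real_complex R) B) z -> z \in rs.
  rewrite eigenvalue_root_char -/q q_split rootZ ?root_prod_XsubC //.
  by rewrite lead_coef_eq0 monic_neq0 // char_poly_monic.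
have : `|t| <= spectral_radius B.
  apply: ub_le_sup.
    (* The sum of the moduli of all roots bounds each of them. *)
    exists (\sum_(z <- rs) ComplexField.Normc.normc z) => _ [z [/eigB zrs ->]].
    rewrite (big_rem z) //= lerDl sumr_ge0 // => -[a b] _.
    exact: sqrtr_ge0.
  exists (real_complex R t); rewrite normc_real; split=> //.
  by rewrite eigenvalue_root_char -map_char_poly fmorph_root.
by move=> /(le_trans (ler_norm t)); rewrite leNgt ltBt.
Qed.

(** * Descending along the family t I - B *)

Lemma poly_right_limit_ge0 {R : realType} (p : {poly R}) (u : R) :
  (forall t, u < t -> 0 <= p.[t]) -> 0 <= p.[u].
Proof.
move=> p_ge0; rewrite leNgt; apply/negP => pu_lt0.
have [|d d_gt0 /(_ (u + d / 2))] := @poly_cont R u p (- p.[u]).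
  by rewrite oppr_gt0.
have : 0 <= p.[u + d / 2] by apply: p_ge0; rewrite ltrDl divr_gt0.
rewrite addrAC subrr add0r gtr0_norm ?divr_gt0 // => pd_ge0.
have d2 : d / 2 < d by lra.
by move=> /(_ d2); rewrite ger0_norm; lra.
Qed.

(** Up to the positive factor [det (t I - B) ^ 2], an entry of the inverse is
the polynomial [adj * det] in [t]. Multiplying by the determinant twice rather
than once avoids having to know its sign. *)
Lemma nonneg_invmx_right_closed {R : realType} {n : nat} (B : 'M[R]_n) (u : R) :
    (forall t, u <= t -> t%:M - B \in unitmx) ->
    (forall t, u < t -> nonneg_mx (invmx (t%:M - B))) ->
  nonneg_mx (invmx (u%:M - B)).
Proof.
move=> uAt pAt k l.
pose P := char_poly_mx B.
have PE t : map_mx (horner_eval t) P = t%:M - B.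
  apply/matrixP => i j.
  by rewrite !mxE /horner_eval /= !hornerE hornerMn hornerX.
pose q := \adj P k l * \det P.
have qE t : u <= t -> q.[t] = \det (t%:M - B) ^+ 2 * invmx (t%:M - B) k l.
  move=> /uAt uA; rewrite /invmx uA mxE.
  rewrite -PE -map_mx_adj det_map_mx mxE /= /horner_eval.
  have dn0 : (\det P).[t] != 0.
    move: uA; rewrite unitmxE unitfE -PE.
    by rewrite det_map_mx.
  by rewrite hornerM expr2 mulrA mulfK // mulrC.
have qu : 0 <= q.[u].
  apply: poly_right_limit_ge0 => t ltut.
  rewrite qE; last exact: ltW.
  by apply: mulr_ge0; [exact: sqr_ge0 | exact: pAt].
move: qu; rewrite qE // pmulr_rge0 // exprn_even_gt0 //=.
by have := uAt u (lexx u); rewrite unitmxE unitfE.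
Qed.

(** With [N] the inverse of [A], one has [A - e I = A (I - e N)], and the second
factor is row diagonally dominant as soon as [e] times each row sum of [N] is
below [1]. *)
Lemma monotone_left_open {R : realType} {n : nat} (A : 'M[R]_n) :
    A \in unitmx -> monotone_mx A ->
  exists2 d : R, 0 < d &
    forall e, 0 <= e -> e < d -> monotone_mx (A - e%:M).
Proof.
move=> uA mA; set N := invmx A.
have N_ge0 : nonneg_mx N by apply/monotone_mx_unitP.
pose S := \sum_k \sum_l N k l.
have S_ge0 : 0 <= S.
  by apply: sumr_ge0 => k _; apply: sumr_ge0 => l _; exact: N_ge0.
have S1_gt0 : 0 < 1 + S by lra.
exists (1 + S)^-1; first by rewrite invr_gt0.
move=> e e_ge0; rewrite -[_^-1]mul1r ltr_pdivlMr // mulrDr mulr1 => eS.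
have -> : A - e%:M = A *m (1%:M - e *: N).
  by rewrite mulmxBr mulmx1 -scalemxAr mulmxV // scalemx1.
move=> x; rewrite -mulmxA => /mA; apply: monotone_row_dominant.
  by move=> k l; rewrite mxE mulr_ge0 ?N_ge0.
move=> k; under eq_bigr do rewrite mxE.
rewrite -mulr_sumr.
have : e * (\sum_l N k l) <= e * S.
  rewrite ler_wpM2l // /S [leRHS](bigD1 k) //= lerDl.
  by apply: sumr_ge0 => k' _; apply: sumr_ge0 => l _; exact: N_ge0.
by lra.
Qed.

(** A continuity argument: the infimum [u] of the parameters above which the
whole family is monotone is attained by closedness on the right, and [u > s]
would contradict openness on the left. *)
Lemma monotone_of_unitmx_above {R : realType} {n : nat} (B : 'M[R]_n) (s : R) :
    nonneg_mx B -> (forall t, s <= t -> t%:M - B \in unitmx) ->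
  monotone_mx (s%:M - B).
Proof.
move=> B_ge0 uA.
pose G : set R :=
  [set t | s <= t /\ forall t', t <= t' -> monotone_mx (t'%:M - B)]%classic.
have s_lb : lbound G s by move=> t [].
have Glb : has_lbound G by exists s.
have G_ne : (G !=set0)%classic.
  (* The sum of all entries dominates every row sum. *)
  pose S := \sum_k \sum_l B k l.
  exists (Num.max s (S + 1)); split=> [|t]; first by rewrite le_max lexx.
  rewrite ge_max => /andP[_ St]; apply: monotone_row_dominant => // k.
  apply: lt_le_trans St; apply: (@le_lt_trans _ _ S); last by rewrite ltrDl.
  rewrite /S [leRHS](bigD1 k) //= lerDl.
  by apply: sumr_ge0 => k' _; apply: sumr_ge0 => l _; exact: B_ge0.
set u := inf G.
have le_su : s <= u by exact: lb_le_inf.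
have above t : u < t -> monotone_mx (t%:M - B).
  move=> ltut; have [||t0 [_ mt0]] := @inf_adherent _ G (t - u).
  - by rewrite subr_gt0.
  - by split.
  by rewrite addrC subrK => /ltW; exact: mt0.
have mu : monotone_mx (u%:M - B).
  have uA' t : u <= t -> t%:M - B \in unitmx.
    by move=> ?; apply: uA; apply: le_trans le_su _.
  apply/monotone_mx_unitP; first exact: uA'.
  apply: nonneg_invmx_right_closed => // t ltut.
  by apply/monotone_mx_unitP; [apply: uA'; exact: ltW | exact: above].
have [d d_gt0 md] := monotone_left_open _ (uA u le_su) mu.
suff <- : u = s by [].
apply/eqP; rewrite eq_le le_su andbT leNgt; apply/negP => lt_su.
pose v := Num.max s (u - d / 2).
have ltvu : v < u by rewrite /v gt_max lt_su; lra.
suff /(ge_inf Glb) : G v by rewrite leNgt ltvu.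
split=> [|t]; first by rewrite /v le_max lexx.
rewrite ge_max => /andP[_ le_t].
have [letu | /above //] := leP t u.
have -> : t%:M - B = u%:M - B - (u - t)%:M.
  by apply/matrixP => k l; rewrite !mxE mulrnBl; lra.
by apply: md; lra.
Qed.

(** * The zero pattern of the inverse *)

Definition Z_matrix {R : realType} {n : nat} (A : 'M[R]_n) : Prop :=
  forall k l, k != l -> A k l <= 0.

Lemma mulmx_invmx_entry {R : realType} {n : nat} (A : 'M[R]_n) k l :
  A \in unitmx -> \sum_m A k m * invmx A m l = (k == l)%:R.
Proof.
by move=> uA; have /matrixP/(_ k l) := mulmxV uA; rewrite !mxE.
Qed.

Lemma diag_mul_invmx {R : realType} {n : nat} (A : 'M[R]_n) k l :
    A \in unitmx ->
  A k k * invmx A k l = (k == l)%:R + \sum_(m | m != k) - A k m * invmx A m l.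
Proof.
move=> uA; rewrite -(mulmx_invmx_entry A k l uA) (bigD1 k) //=.
rewrite -addrA -big_split /= big1 ?addr0 // => m _.
by rewrite mulNr subrr.
Qed.

(** The product [A_kk N_kk] is [1] plus non-negative terms, so both factors
have the same strict sign, and [N_kk] is non-negative. *)
Lemma Z_matrix_diag_gt0 {R : realType} {n : nat} (A : 'M[R]_n) k :
    Z_matrix A -> A \in unitmx -> nonneg_mx (invmx A) ->
  0 < A k k /\ 0 < invmx A k k.
Proof.
move=> ZA uA N_ge0.
have AN_gt0 : 0 < A k k * invmx A k k.
  rewrite diag_mul_invmx // eqxx ltr_pwDl //.
  apply: sumr_ge0 => m mk.
  by rewrite mulr_ge0 // oppr_ge0 ZA // eq_sym.
have N_gt0 : 0 < invmx A k k.
  rewrite lt0r N_ge0 andbT; apply: contraTneq AN_gt0 => ->.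
  by rewrite mulr0 ltxx.
by rewrite -(pmulr_lgt0 _ N_gt0).
Qed.

(** The edge contributes the positive term [(- A_km) N_ml] to a sum of
non-negative terms equal to [A_kk N_kl]. *)
Lemma invmx_gt0_edge {R : realType} {n : nat} (A : 'M[R]_n) k m l :
    Z_matrix A -> A \in unitmx -> nonneg_mx (invmx A) ->
  digraph_edge A k m -> 0 < invmx A m l -> 0 < invmx A k l.
Proof.
move=> ZA uA N_ge0 /andP[km Akm] Nml.
have [Akk_gt0 _] := Z_matrix_diag_gt0 A k ZA uA N_ge0.
rewrite -(pmulr_rgt0 _ Akk_gt0) diag_mul_invmx // ltr_wpDl ?ler0n //.
rewrite (bigD1 m) 1?eq_sym //= ltr_pwDl //.
  by rewrite mulr_gt0 // oppr_gt0 lt_neqAle Akm ZA.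
apply: sumr_ge0 => j /andP[jk _].
by rewrite mulr_ge0 // oppr_ge0 ZA // eq_sym.
Qed.

Lemma invmx_gt0_path {R : realType} {n : nat} (A : 'M[R]_n) k p :
    Z_matrix A -> A \in unitmx -> nonneg_mx (invmx A) ->
  path (digraph_edge A) k p -> 0 < invmx A k (last k p).
Proof.
move=> ZA uA N_ge0.
elim: p k => [|m p IHp] k /=.
  by case: (Z_matrix_diag_gt0 A k ZA uA N_ge0).
by case/andP=> km /IHp; exact: invmx_gt0_edge.
Qed.

(** Let [S] be the set of vertices connected to [l], [x] the column [l] of the
inverse and [y] its restriction to [S]. In the rows of [S], dropping the entries
of [x] outside [S] can only increase [A x], since these are non-negative and
meet off-diagonal, hence non-positive, entries of [A]. In the other rows [A y]
vanishes, since no edge enters [S] from outside, and so does [A x = e_l], since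
[l] is in [S]. Hence [A x <= A y], so [x <= y], and [y] is zero off [S]. *)
Lemma invmx_le0_disconnected {R : realType} {n : nat} (A : 'M[R]_n) k l :
    Z_matrix A -> A \in unitmx -> monotone_mx A ->
  ~~ connect (digraph_edge A) k l -> invmx A k l <= 0.
Proof.
move=> ZA uA mA Nkl.
have N_ge0 : nonneg_mx (invmx A) by apply/monotone_mx_unitP.
pose S m := connect (digraph_edge A) m l.
pose x := col l (invmx A).
pose y : 'cV[R]_n := \col_m (if S m then x m 0 else 0).
suff /(_ k) : nonneg_cV (y - x).
  by rewrite !mxE /S (negPf Nkl) sub0r oppr_ge0.
apply: mA => m; rewrite mulmxBr !mxE subr_ge0.
have [Sm | NSm] := boolP (S m).
  apply: ler_sum => j _; rewrite [y _ _]mxE.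
  have [//|NSj] := boolP (S j).
  rewrite mulr0 [x _ _]mxE mulr_le0_ge0 // ZA //.
  by apply: contraNneq NSj => <-.
have -> : \sum_j A m j * x j 0 = 0.
  have [eml|/negPf ml] := eqVneq m l; first by rewrite /S eml connect0 in NSm.
  under eq_bigr do rewrite mxE.
  by rewrite mulmx_invmx_entry // ml.
rewrite big1 // => j _; rewrite [y _ _]mxE.
case: ifP => [Sj|]; last by rewrite mulr0.
have [-> | Amj] := eqVneq (A m j) 0; first by rewrite mul0r.
case/negP: (NSm); apply: connect_trans (Sj); apply: connect1.
apply/andP; split=> //.
by apply: contraNneq NSm => ->.
Qed.

Theorem theorem2p3 (R : realType) (n : nat) (A : 'M[R]_n) (hA : is_M_matrix A)
    (i j : 'I_n) (hij : i != j) :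
  0 < invmx A i j <-> has_path A i j.
Proof.
have [s [B [B_ge0 ltBs defA]]] := hA.
have uAt t : s <= t -> t%:M - B \in unitmx.
  by move=> le_st; apply: unitmx_above_spectral_radius; apply: lt_le_trans le_st.
have uA : A \in unitmx by rewrite defA uAt.
have mA : monotone_mx A by rewrite defA; exact: monotone_of_unitmx_above.
have ZA : Z_matrix A.
  by move=> k l /negPf kl; rewrite defA !mxE kl sub0r oppr_le0.
split=> [Nij | [p [pA <- _]]]; last first.
  by apply: invmx_gt0_path => //; apply/monotone_mx_unitP.
have /connectP[p pA ->] : connect (digraph_edge A) i j.
  apply: contraTT Nij => Nij; rewrite -leNgt.
  exact: invmx_le0_disconnected.
by case/shortenP: pA => p' pA' Up' _; exists p'.
Qed.
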